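(* If $D$ and $H$ are Bott equivalent acyclic digraphs, then $D$ and $H$ have the identical level sequence.
   Context: A digraph $D=(V,E)$ consists of a finite vertex set $V$ and a set $E$ of ordered pairs $(u,v)$ of distinct vertices (arcs). $D$ is acyclic if its vertices can be ordered $v_1,\dots,v_n$ so that $i<j$ for each arc $(v_i,v_j)$. Let $N_D^+(v)=\{w:(v,w)\in E\}$ (out-neighbors) and $N_D^-(v)=\{u:(u,v)\in E\}$ (in-neighbors). Bott equivalence. Local complementation at a vertex $v$: $D*v$ is the digraph obtained from $D$ by toggling (adding if absent, removing if present) the arc $(u,w)$ for each pair $(u,w)\in N_D^-(v)\times N_D^+(v)$ with $u\ne w$. Slide: for two distinct vertices $v,w$ with $N_D^-(v)=N_D^-(w)$, $D\Delta vw$ is the digraph obtained from $D$ by replacing $N_D^+(w)$ by the symmetric difference $N_D^+(w)\Delta N_D^+(v)$. These operations preserve acyclicity. An acyclic digraph $H$ is Bott equivalent to an acyclic digraph $D$ if $H$ is isomorphic to a digraph obtained from $D$ by successively applying (finitely many) local complementations and slides. Levels. For an acyclic digraph $D$, $L_k(D)$ is the set of vertices $v$ such that a longest directed path of $D$ ending at $v$ has exactly $k$ edges. If $D$ has $n$ vertices, its level sequence is $(|L_0(D)|,|L_1(D)|,\dots,|L_{n-1}(D)|)$. *)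

(* Defs.v *)
From HB Require Import structures.
From mathcomp Require Import all_boot.
From Stdlib Require Export Relations.Relation_Operators.

Set Implicit Arguments.
Unset Strict Implicit.
Unset Printing Implicit Defensive.

Record digraph (V : finType) := Digraph {
  arcs :> {set V * V};
  loopless : [forall v, (v, v) \notin arcs]
}.

HB.instance Definition _ (V : finType) := [isSub for @arcs V].

Definition out_nbrs (V : finType) (D : digraph V) (v : V) : {set V} :=
  [set w | (v, w) \in arcs D].

Definition in_nbrs (V : finType) (D : digraph V) (v : V) : {set V} :=
  [set u | (u, v) \in arcs D].

Definition symdiff (T : finType) (A B : {set T}) : {set T} :=
  (A :\: B) :|: (B :\: A).

Definition acyclic (V : finType) (D : digraph V) : Prop :=
  exists f : 'I_#|V| -> V,
    bijective f /\ forall i j, (f i, f j) \in arcs D -> i < j.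

Definition local_compl_arcs (V : finType) (D : digraph V) (v : V) :
    {set V * V} :=
  symdiff (arcs D)
    [set e | [&& e.1 \in in_nbrs D v, e.2 \in out_nbrs D v & e.1 != e.2]].

Lemma local_compl_loopless (V : finType) (D : digraph V) (v : V) :
  [forall x, (x, x) \notin local_compl_arcs D v].
Proof.
apply/forallP => x; have /forallP/(_ x) := loopless D.
by rewrite !inE /= eqxx !andbF /= => /negbTE ->.
Qed.

Definition local_compl (V : finType) (D : digraph V) (v : V) : digraph V :=
  Digraph (local_compl_loopless D v).

Definition slide_arcs (V : finType) (D : digraph V) (v w : V) : {set V * V} :=
  [set e | e.2 \in if e.1 == w then symdiff (out_nbrs D w) (out_nbrs D v)
                   else out_nbrs D e.1].

(* An arc from v to w would make v an in-neighbor of w, hence of itself, so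
   replacing the out-neighborhood of w does not create a loop at w. *)
Lemma slide_loopless (V : finType) (D : digraph V) (v w : V) :
  in_nbrs D v = in_nbrs D w -> [forall x, (x, x) \notin slide_arcs D v w].
Proof.
move=> /setP/(_ v); rewrite !inE => vw; apply/forallP => x.
have /forallP L := loopless D.
rewrite inE /=; case: eqP => [->|_]; last by rewrite inE; exact: L.
by rewrite !inE -vw (negbTE (L v)) (negbTE (L w)).
Qed.

Definition slide (V : finType) (D : digraph V) (v w : V)
    (hvw : in_nbrs D v = in_nbrs D w) : digraph V :=
  Digraph (slide_loopless hvw).

Inductive bott_step (V : finType) (D : digraph V) : digraph V -> Prop :=
| BottLocalCompl (v : V) : bott_step D (local_compl D v)
| BottSlide (v w : V) (hvw : in_nbrs D v = in_nbrs D w) :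
    v != w -> bott_step D (slide hvw).

Definition isomorphic (V W : finType) (D : digraph V) (H : digraph W) : Prop :=
  exists f : V -> W,
    bijective f /\
    forall u v, ((u, v) \in arcs D) = ((f u, f v) \in arcs H).

Definition bott_equivalent (V W : finType) (D : digraph V) (H : digraph W) :
    Prop :=
  exists D' : digraph V,
    clos_refl_trans (digraph V) (@bott_step V) D D' /\ isomorphic D' H.

Definition has_path_to (V : finType) (D : digraph V) (v : V) (k : nat) : bool :=
  [exists x : V, exists p : k.-tuple V,
    [&& path (fun a b => (a, b) \in arcs D) x p, uniq (x :: p)
      & last x p == v]].

(* A path has distinct vertices, hence fewer than #|V| arcs, so the bound on
   the range of the maximum loses nothing; k = 0 always qualifies. *)
Definition longest_path_to (V : finType) (D : digraph V) (v : V) : nat :=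
  \max_(k < #|V| | has_path_to D v k) k.

Definition level (V : finType) (D : digraph V) (k : nat) : {set V} :=
  [set v | longest_path_to D v == k].

Definition level_sequence (V : finType) (D : digraph V) : seq nat :=
  mkseq (fun k => #|level D k|) #|V|.

(* Main.v *)
Require Import Defs.
From mathcomp Require Import all_boot.

Set Implicit Arguments.
Unset Strict Implicit.
Unset Printing Implicit Defensive.

(** In an acyclic digraph the length of a longest path ending at a vertex is the
    only function that strictly increases along arcs and, at each vertex where
    it is positive, increases by exactly one along some incoming arc.  Such a
    function for [D] is still one after a local complementation, which toggles
    only arcs along which it increases by at least two, and after a slide,
    because vertices with the same in-neighbors have the same value.  So both
    operations fix the level of every vertex. *)

Definition ranking (V : finType) (D : digraph V) (l : V -> nat) : Prop :=
  (forall u v, (u, v) \in arcs D -> l u < l v) /\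
  (forall v, 0 < l v -> exists2 u, (u, v) \in arcs D & (l u).+1 = l v).

Section Ranking.

Variables (V : finType) (D : digraph V).

Lemma has_path_toP (v : V) (k : nat) :
  reflect (exists x p, [/\ path (fun a b => (a, b) \in arcs D) x p,
                           uniq (x :: p), last x p = v & size p = k])
          (has_path_to D v k).
Proof.
apply: (iffP existsP) => [[x /existsP[p /and3P[Dp Up /eqP lp]]]|].
  by exists x, p; rewrite size_tuple.
move=> [x [p [Dp Up lp /eqP sp]]]; exists x; apply/existsP; exists (Tuple sp).
by apply/and3P; split=> //; apply/eqP.
Qed.

Lemma has_path_to0 (v : V) : has_path_to D v 0.
Proof. by apply/has_path_toP; exists v, [::]. Qed.

Lemma has_path_to_lt_card (v : V) (k : nat) : has_path_to D v k -> k < #|V|.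
Proof.
case/has_path_toP=> x [p [_ /card_uniqP Up _ <-]].
by rewrite -[(size p).+1]/(size (x :: p)) -Up max_card.
Qed.

Lemma leq_longest_path_to (v : V) (k : nat) :
  has_path_to D v k -> k <= longest_path_to D v.
Proof.
move=> Pk; pose i := Ordinal (has_path_to_lt_card Pk).
exact: (@leq_bigmax_cond _ (fun j : 'I_#|V| => has_path_to D v j)
                         (fun j => j : nat) i Pk).
Qed.

Lemma has_path_to_longest (v : V) : has_path_to D v (longest_path_to D v).
Proof.
rewrite /longest_path_to; apply: (big_ind (has_path_to D v)) => [|j k Pj Pk | //].
  exact: has_path_to0.
by rewrite /maxn; case: ifP.
Qed.

(** The first bound caps the length of paths ending at a vertex. The second shows that a vertex of
    rank above that of the endpoint is not on the path. *)
Lemma path_rank (l : V -> nat) (x : V) (p : seq V) :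
    (forall u v, (u, v) \in arcs D -> l u < l v) ->
    path (fun a b => (a, b) \in arcs D) x p ->
  [/\ size p <= l (last x p) & all (fun y => l y <= l (last x p)) (x :: p)].
Proof.
move=> incl; elim/last_ind: p => [|p y IHp]; first by rewrite /= leqnn.
rewrite rcons_path last_rcons size_rcons => /andP[Dp /incl lt_y].
have [le_p /allP all_p] := IHp Dp; split; first exact: leq_ltn_trans lt_y.
rewrite -rcons_cons all_rcons leqnn; apply/allP=> z /all_p le_z.
exact: leq_trans le_z (ltnW lt_y).
Qed.

(** Paths must have distinct vertices, so extending one needs [v] to be new. Any [l] increasing
    along arcs ensures this: the vertices of a path ending at [u] have rank at most [l u], which is
    less than [l v]. *)
Lemma has_path_to_rcons (l : V -> nat) (u v : V) (k : nat) :
    (forall u v, (u, v) \in arcs D -> l u < l v) ->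
  (u, v) \in arcs D -> has_path_to D u k -> has_path_to D v k.+1.
Proof.
move=> incl Duv /has_path_toP[x [p [Dp Up lp sp]]].
apply/has_path_toP; exists x, (rcons p v).
rewrite rcons_path Dp lp Duv last_rcons size_rcons sp -rcons_cons rcons_uniq Up.
have [_ /allP all_p] := path_rank incl Dp; rewrite lp in all_p.
by split=> //; rewrite andbT; apply/negP => /all_p; rewrite leqNgt incl.
Qed.

(** Each arc raises [l] by at least one, so no path to [v] has more than [l v] arcs. Going back from
    [v] along arcs that raise [l] by exactly one, until rank 0, gives a path with [l v] arcs. *)
Lemma longest_path_to_ranking (l : V -> nat) :
  ranking D l -> longest_path_to D =1 l.
Proof.
move=> [incl tight] v; apply/eqP; rewrite eqn_leq; apply/andP; split.
  have /has_path_toP[x [p [Dp _ <- <-]]] := has_path_to_longest v.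
  by have [] := path_rank incl Dp.
apply: leq_longest_path_to.
have [n] := ubnP (l v); elim: n v => // n IHn v le_n.
have [->|/tight[u Duv lu]] := posnP (l v); first exact: has_path_to0.
by rewrite -lu; apply: has_path_to_rcons incl Duv (IHn u _); rewrite lu.
Qed.

Lemma acyclic_ranking : acyclic D -> ranking D (longest_path_to D).
Proof.
case=> f [[g fK gK] lt_f].
(* The position [g] in the acyclic ordering serves only as a rank that lets paths be extended. *)
have incl u v : (u, v) \in arcs D -> g u < g v.
  by rewrite -{1}[u]gK -{1}[v]gK; exact: lt_f.
split=> [u v Duv | v].
  apply: leq_longest_path_to.
  exact: (has_path_to_rcons (l := g)) (has_path_to_longest u).
have /has_path_toP[x [p]] := has_path_to_longest v.
case/lastP: p => [[_ _ _ <-] // | p y].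
rewrite rcons_path last_rcons size_rcons -rcons_cons rcons_uniq.
move=> [/andP[Dp Dy] /andP[_ Up] eq_y sp] _; rewrite eq_y in Dy.
(* The witness is the penultimate vertex of a longest path to [v]. A longer path to it than [p]
   would extend to one to [v] that exceeds the maximum. *)
exists (last x p) => //; apply/eqP; rewrite eqn_leq; apply/andP; split.
  apply: leq_longest_path_to.
  exact: (has_path_to_rcons (l := g)) (has_path_to_longest _).
by rewrite -sp ltnS; apply: leq_longest_path_to; apply/has_path_toP; exists x, p.
Qed.

(** A positive value is one more than that of some in-neighbor, and a shared in-neighbor forces the
    other vertex at least as high. The two inequalities follow by symmetry. *)
Lemma ranking_eq_in_nbrs (l : V -> nat) (v w : V) :
  ranking D l -> in_nbrs D v = in_nbrs D w -> l v = l w.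
Proof.
move=> [incl tight].
suff le a b : in_nbrs D a = in_nbrs D b -> l a <= l b.
  by move=> eq_vw; apply/eqP; rewrite eqn_leq !le.
move=> /setP eq_ab; have [-> // | /tight[u Dua <-]] := posnP (l a).
by apply: incl; have := eq_ab u; rewrite !inE Dua => <-.
Qed.

Lemma ranking_local_compl (l : V -> nat) (v : V) :
  ranking D l -> ranking (local_compl D v) l.
Proof.
move=> [incl tight]; split=> [u w | w /tight[u Duw lu]].
  rewrite !inE /= => /orP[/andP[_ /incl] // | /andP[_ /and3P[/incl uv /incl vw _]]].
  exact: ltn_trans vw.
exists u; rewrite // !inE /= Duw /= andbT orbF.
(* The arc from [u] to [w] is not toggled: with [v] strictly between in rank, [l w] would be at
   least [l u + 2]. *)
apply/negP => /and3P[/incl uv /incl vw _].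
by have := leq_ltn_trans uv vw; rewrite lu ltnn.
Qed.

Lemma ranking_slide (l : V -> nat) (v w : V) (hvw : in_nbrs D v = in_nbrs D w) :
  v != w -> ranking D l -> ranking (slide hvw) l.
Proof.
move=> ne_vw rkl; have eq_l := ranking_eq_in_nbrs rkl hvw.
case: rkl => incl tight; split=> [u x | x /tight[u Dux lu]].
  rewrite !inE /=; case: eqP => [->|_]; last by rewrite inE => /incl.
  by rewrite !inE => /orP[/andP[_ /incl] | /andP[_ /incl]]; rewrite ?eq_l.
have [eq_u | ne_u] := eqVneq u w; last first.
  by exists u; rewrite // inE /= (negbTE ne_u) inE.
rewrite eq_u in Dux lu.
(* Only arcs out of [w] change. The arc from [w] to [x] is lost exactly when [v] also has an arc to
   [x]; that arc stays, and [v] replaces [w] as witness because their ranks agree. *)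
have [Dvx | nDvx] := boolP ((v, x) \in arcs D).
  by exists v; rewrite ?eq_l // inE /= (negbTE ne_vw) inE.
by exists w; rewrite // inE /= eqxx !inE Dux nDvx.
Qed.

Lemma level_sequence_ranking (l : V -> nat) :
  ranking D l -> level_sequence D = mkseq (fun k => #|[set v | l v == k]|) #|V|.
Proof.
move=> rkl; apply: eq_mkseq => k; apply: eq_card => v.
by rewrite !inE (longest_path_to_ranking rkl).
Qed.

End Ranking.

Lemma ranking_bott_step (V : finType) (D D' : digraph V) (l : V -> nat) :
  bott_step D D' -> ranking D l -> ranking D' l.
Proof.
by case=> [v | v w hvw ne_vw];
   [exact: ranking_local_compl | exact: ranking_slide].
Qed.

Lemma ranking_bott_steps (V : finType) (D D' : digraph V) (l : V -> nat) :
  clos_refl_trans (digraph V) (@bott_step V) D D' -> ranking D l -> ranking D' l.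
Proof.
elim=> [D1 D2 | // | D1 D2 D3 _ IH12 _ IH23 /IH12 /IH23 //].
exact: ranking_bott_step.
Qed.

Lemma level_sequence_isomorphic (V W : finType) (D : digraph V) (H : digraph W)
    (l : V -> nat) :
  ranking D l -> isomorphic D H -> level_sequence D = level_sequence H.
Proof.
move=> rkl [f [bij_f arc_f]]; have [g fK gK] := bij_f.
(* Transporting [l] along the inverse of the isomorphism makes [f] carry each level of [D] onto the
   same level of [H]. *)
have rkH : ranking H (l \o g).
  case: rkl => incl tight; split=> [u v | v /tight[u Duv lu]] /=.
    by rewrite -{1}[u]gK -{1}[v]gK -arc_f; exact: incl.
  by exists (f u); rewrite ?fK // -[v]gK -arc_f.
rewrite (level_sequence_ranking rkl) (level_sequence_ranking rkH).
rewrite (bij_eq_card bij_f); apply: eq_mkseq => k.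
rewrite -(card_imset _ (bij_inj bij_f)); apply: eq_card => w.
by rewrite -[w]gK (mem_imset _ _ (bij_inj bij_f)) !inE /= fK.
Qed.

Theorem proposition5p1 (V W : finType) (D : digraph V) (H : digraph W) :
  acyclic D -> acyclic H -> bott_equivalent D H ->
  level_sequence D = level_sequence H.
Proof.
move=> /acyclic_ranking rkD _ [D' [DD' isoH]].
have rkD' := ranking_bott_steps DD' rkD.
(* Both level sequences count the level sets of one function, [longest_path_to D]. *)
rewrite (level_sequence_ranking rkD) -(level_sequence_ranking rkD').
exact: level_sequence_isomorphic rkD' isoH.
Qed.
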